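(* The substitution graph $\mathcal{U}$ generated by $\overrightarrow{G}$ and $\overrightarrow{J}$ is hyperbolic provided that (i) $K$ is nilpotent, and (ii) either all vertices in the coupling graph $\overrightarrow{\mathcal{G}}$ have out-degree at most $1$, or all vertices in $\overrightarrow{\mathcal{G}}$ have in-degree at most $1$.
   Context: Setting. Let $N\ge 2$, $\Sigma=\{1,\dots,N\}$, and let $\Sigma'=\{1',\dots,N'\}$ be a disjoint copy of $\Sigma$. Let $\overrightarrow{G}$ be a directed simple graph with vertex set $\Sigma$ (no loops, and at most one directed edge between any two vertices), with $E(\overrightarrow{G})\neq\emptyset$. Let $\overrightarrow{J}$ be a directed graph on $\Sigma\cup\Sigma'$ whose edge set is a nonempty subset of $\{(i,j'): i,j\in\Sigma\}$. Substitution graph. Let $\Sigma_n$ be the set of words of length $n$ over $\Sigma$ ($\Sigma_0=\{\varnothing\}$) and $V=\bigcup_{n\ge 0}\Sigma_n$. For a nonempty word $u$, $u^-$ is the word obtained by deleting the last letter of $u$ and $\varphi(u)\in\Sigma$ is the last letter of $u$. The vertical edges are $\overrightarrow{E}_v=\{(w,w\sigma): w\in V,\sigma\in\Sigma\}$. The set $\overrightarrow{E}_h$ of horizontal edges is defined recursively: for $n\ge1$ and distinct $u,v\in\Sigma_n$, $(u,v)\in\overrightarrow{E}_h$ iff either (i) $u^-=v^-$ and $(\varphi(u),\varphi(v))\in E(\overrightarrow{G})$, or (ii) $(u^-,v^-)\in\overrightarrow{E}_h$ and $(\varphi(u),\varphi(v)')\in E(\overrightarrow{J})$. The substitution graph $\mathcal{U}=(V,E)$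 is the underlying undirected graph of $(V,\overrightarrow{E}_v\cup\overrightarrow{E}_h)$. Hyperbolicity. Let $d$ be the graph distance in $\mathcal{U}$, $|u|=d(\varnothing,u)$, and $|u\wedge v|=\frac12(|u|+|v|-d(u,v))$. $\mathcal{U}$ is hyperbolic if there is $\delta\ge0$ with $|u\wedge v|\ge\min\{|u\wedge w|,|w\wedge v|\}-\delta$ for all $u,v,w\in V$. Matrix and coupling graph. $K$ is the $N\times N$ $0$-$1$ matrix with $K_{i,j}=1$ iff $(i,j')\in E(\overrightarrow{J})$. The coupling graph $\overrightarrow{\mathcal{G}}$ is the directed graph with vertex set $\Sigma\cup\Sigma'$ and edge set $E(\overrightarrow{G})\cup E(\overrightarrow{G'})\cup E(\overrightarrow{J})$, where $\overrightarrow{G'}$ is the copy of $\overrightarrow{G}$ on $\Sigma'$, i.e. $(u',v')\in E(\overrightarrow{G'})$ iff $(u,v)\in E(\overrightarrow{G})$. *)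

(* Defs.v *)
From HB Require Import structures.
From mathcomp Require Import all_boot all_order all_algebra.
From mathcomp Require Import boolp reals.

Set Implicit Arguments.
Unset Strict Implicit.
Unset Printing Implicit Defensive.

Import Order.TTheory GRing.Theory Num.Theory.
Local Open Scope ring_scope.

Section Graphs.
Variables (V : Type) (e : V -> V -> Prop).

Definition underlying (x y : V) : Prop := e x y \/ e y x.

Inductive walk : V -> V -> nat -> Prop :=
| walk_nil x : walk x x 0
| walk_cons x y z n : e x y -> walk y z n -> walk x z n.+1.

Definition graph_connected : Prop := forall x y, exists n, walk x y n.

Lemma connected_asbool (ce : graph_connected) x y :
  exists n, `[< walk x y n >].
Proof. by have [n xyn] := ce x y; exists n; apply/asboolP. Qed.

Definition gdist (ce : graph_connected) (x y : V) : nat :=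
  ex_minn (connected_asbool ce x y).

Variables (R : realType) (ce : graph_connected) (o : V).

Definition gromov_product (x y : V) : R :=
  ((gdist ce o x)%:R + (gdist ce o y)%:R - (gdist ce x y)%:R) / 2.

Definition hyperbolic : Prop :=
  exists delta : R, 0 <= delta /\
    forall u v w : V,
      Num.min (gromov_product u w) (gromov_product w v) - delta
        <= gromov_product u v.

End Graphs.

Lemma walk_cat (V : Type) (e : V -> V -> Prop) x y z m n :
  walk e x y m -> walk e y z n -> walk e x z (m + n)%N.
Proof.
elim=> // {x y m} x y t m xy _ IH yz.
by rewrite addSn; apply: walk_cons xy (IH yz).
Qed.

Section Substitution.
Variable N : nat.

(* The alphabet is 'I_N; in 'I_N + 'I_N, inl i stands for the letter i and
   inr i for its primed copy i'.  Words are read from left to right, so that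
   rcons w i is the child of w obtained by appending the letter i. *)
Variables (G : rel 'I_N) (J : rel ('I_N + 'I_N)).

Definition vertical (x y : seq 'I_N) : Prop := exists i, y = rcons x i.

(* The constructors match on words rcons u i, whose parent is u and whose last
   letter is i.  Related words always have the same length. *)
Inductive horizontal : seq 'I_N -> seq 'I_N -> Prop :=
| horizontal_siblings w i j :
    rcons w i <> rcons w j -> G i j ->
    horizontal (rcons w i) (rcons w j)
| horizontal_lift u v i j :
    rcons u i <> rcons v j -> horizontal u v -> J (inl i) (inr j) ->
    horizontal (rcons u i) (rcons v j).

Definition substitution_graph : seq 'I_N -> seq 'I_N -> Prop :=
  underlying (fun x y => vertical x y \/ horizontal x y).

Lemma substitution_graph_connected : graph_connected substitution_graph.
Proof.
have to_root x : exists n, walk substitution_graph x [::] n.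
  elim/last_ind: x => [|x i [n xn]]; first by exists 0%N; apply: walk_nil.
  by exists n.+1; apply: walk_cons xn; right; left; exists i.
have from_root x : exists n, walk substitution_graph [::] x n.
  elim/last_ind: x => [|x i [n xn]]; first by exists 0%N; apply: walk_nil.
  exists (n + 1)%N; apply: (walk_cat xn); apply: walk_cons (walk_nil _ _).
  by left; left; exists i.
move=> x y; have [[m xm] [n yn]] := (to_root x, from_root y).
by exists (m + n)%N; apply: walk_cat xm yn.
Qed.

Definition substitution_hyperbolic (R : realType) : Prop :=
  hyperbolic R substitution_graph_connected [::].

Definition K_matrix : 'M[int]_N := \matrix_(i, j) (J (inl i) (inr j))%:R.

Definition coupling_graph : rel ('I_N + 'I_N) := fun x y =>
  match x, y with
  | inl i, inl j => G i j
  | inr i, inr j => G i j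
  | _, _ => false
  end || J x y.

End Substitution.

Definition mx_nilpotent (N : nat) (A : 'M[int]_N) : Prop :=
  exists m : nat, A ^+ m = 0.

Definition out_degree (T : finType) (e : rel T) (x : T) : nat :=
  #|[set y | e x y]|.
Definition in_degree (T : finType) (e : rel T) (x : T) : nat :=
  #|[set y | e y x]|.

(* Main.v *)
Require Import Defs.
From mathcomp Require Import all_boot all_order all_algebra.
From mathcomp Require Import reals.
From mathcomp Require Import boolp zify lra.

Set Implicit Arguments.
Unset Strict Implicit.
Unset Printing Implicit Defensive.

Import Order.TTheory GRing.Theory Num.Theory.

(** Every walk of the substitution graph can be pushed upwards, so that it
    climbs from its first endpoint to some level [l], crosses that level by
    horizontal edges, and descends: a horizontal edge projects to a horizontal
    edge or to a point on the level above ([walk_normal_form]).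

    Crossing at level [l] costs the length of the horizontal walk; moving the
    crossing one level up costs two vertical edges. Two facts make the crossing
    short.
    - The degree condition implies that every word has at most one outgoing (or
      at most one incoming) horizontal edge. In such a graph an undirected walk
      can be replaced by two directed walks meeting at a common vertex
      ([functional_fold]).
    - Along a directed horizontal walk the last letters follow edges of [G],
      which disappear in the projection to the parents, or edges of [J]. If
      [K ^+ m = 0] then [m] consecutive edges of [J] are impossible, so each
      block of [m] directed edges loses at least one by projection
      ([horizontal_block_shortens]).
    Hence a crossing of length at least [4 m] is shortened by two: either
    folding already does so, or one of the two directed walks has length at
    least [2 m] and loses two edges by projection. This pays for moving the
    crossing one level up ([undirected_walk_shortens]), so crossings can be
    taken of length at most [4 m] ([short_crossing]).

    If a geodesic crosses at level [l], the Gromov product of its endpoints is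
    at most [l]. Let geodesics from [u] to [w] and from [w] to [v] cross at
    levels [l1] and [l2]. Both crossings project to level [minn l1 l2] and
    concatenate there to a horizontal walk of length at most [8 m] between
    ancestors of [u] and [v]. So the Gromov product of [u] and [v] is at least
    [minn l1 l2 - 4 m], which is hyperbolicity with constant [4 m]
    ([hyperbolic_of_short_crossings]). *)

(** * Walks *)

Section Walks.
Variables (V : Type) (e : V -> V -> Prop).

Lemma walk_edge x y : e x y -> walk e x y 1.
Proof. by move=> xy; apply: walk_cons xy (walk_nil _ _). Qed.

Lemma walk_rcons x y z n : walk e x y n -> e y z -> walk e x z n.+1.
Proof. by move=> xy /walk_edge yz; rewrite -addn1; apply: walk_cat xy yz. Qed.

Lemma walk_flip x y n : walk (fun u v => e v u) x y n -> walk e y x n.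
Proof.
elim=> [z|{x y n} x y z n yx _ zy]; first exact: walk_nil.
exact: walk_rcons zy yx.
Qed.

Lemma walk_split x y m n :
  walk e x y (m + n) -> exists2 z, walk e x z m & walk e z y n.
Proof.
elim: m x => [|m IH] x; first by exists x => //; apply: walk_nil.
rewrite addSn => xy; inversion xy as [|? t ? ? xt ty]; subst.
by have [z tz zy] := IH _ ty; exists z => //; apply: walk_cons xt tz.
Qed.

Lemma walk_mono (e' : V -> V -> Prop) x y n :
  (forall u v, e u v -> e' u v) -> walk e x y n -> walk e' x y n.
Proof.
move=> ee'; elim=> [z|{x y n} x y z n xy _ yz]; first exact: walk_nil.
exact: walk_cons (ee' _ _ xy) yz.
Qed.

Lemma walk_project (f : V -> V) x y n :
    (forall u v, e u v -> f u = f v \/ e (f u) (f v)) ->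
  walk e x y n -> exists2 p, p <= n & walk e (f x) (f y) p.
Proof.
move=> fe; elim=> [z|{x y n} x y z n xy _ [p pn yz]].
  by exists 0 => //; apply: walk_nil.
case: (fe _ _ xy) => [->|fxy]; first by exists p => //; lia.
by exists p.+1 => //; apply: walk_cons fxy yz.
Qed.

Definition functional := forall x y z, e x y -> e x z -> y = z.

(** A valley of the walk, where it follows an edge backwards and then an edge
    forwards, backtracks and can be cancelled; what remains climbs and then
    descends. *)
Lemma functional_fold x y n :
    functional -> walk (underlying e) x y n ->
  exists c p q, [/\ walk e x c p, walk e y c q & p + q <= n].
Proof.
move=> fun_e; elim=> [z|{x y n} x t y n xt _ [c [p [q [tc yc pqn]]]]].
  by exists z, 0, 0; split=> //; apply: walk_nil.
case: xt => [xt|tx].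
  by exists c, p.+1, q; split=> //; apply: walk_cons xt tc.
inversion tc as [? tc0|? t' ? k tt' t'c]; subst.
  exists x, 0, q.+1; split; [exact: walk_nil| |lia].
  exact: walk_rcons yc tx.
rewrite (fun_e _ _ _ tx tt').
by exists c, k, q; split=> //; lia.
Qed.

Section Distance.
Hypothesis ce : graph_connected e.

Lemma gdist_le x y n : walk e x y n -> gdist ce x y <= n.
Proof.
rewrite /gdist; case: ex_minnP => m _ min_m xy.
by apply: min_m; apply/asboolP.
Qed.

Lemma gdist_walk x y : walk e x y (gdist ce x y).
Proof. by rewrite /gdist; case: ex_minnP => m /asboolP. Qed.

End Distance.
End Walks.

Lemma walk_underlying_sym (V : Type) (e : V -> V -> Prop) x y n :
  walk (underlying e) x y n -> walk (underlying e) y x n.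
Proof.
by move=> xy; apply: walk_flip; apply: walk_mono xy => u v [|]; [right|left].
Qed.

(** * Nonnegative nilpotent matrices have no long walks *)

Section Nilpotent.
Local Open Scope ring_scope.
Variables (N : nat) (J : rel ('I_N + 'I_N)).

Let K := K_matrix J.

Definition K_edge (i j : 'I_N) : Prop := J (inl i) (inr j).

Lemma K_matrix_ge0 i j : 0 <= K i j.
Proof. by rewrite mxE ler0n. Qed.

Lemma K_exp_ge0 n i j : 0 <= (K ^+ n) i j.
Proof.
elim: n i j => [|n IH] i j; first by rewrite expr0 mxE ler0n.
rewrite exprS mxE; apply: sumr_ge0 => k _.
by rewrite mulr_ge0 ?K_matrix_ge0.
Qed.

(** The entries of [K ^+ n] count the walks of length [n]. *)
Lemma K_walk_exp_gt0 i j n : walk K_edge i j n -> 0 < (K ^+ n) i j.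
Proof.
elim=> [z|{i j n} i k j n ik _ kj]; first by rewrite expr0 mxE eqxx ltr01.
rewrite exprS mxE (bigD1 k) //=; apply: ltr_wpDr.
  by apply: sumr_ge0 => l _; rewrite mulr_ge0 ?K_matrix_ge0 ?K_exp_ge0.
by rewrite mulr_gt0 // mxE ik ltr01.
Qed.

Lemma K_nilpotent_no_walk m i j : K ^+ m = 0 -> ~ walk K_edge i j m.
Proof. by move=> Km /K_walk_exp_gt0; rewrite Km mxE ltxx. Qed.

End Nilpotent.

(** * Horizontal edges *)

Section Substitution.
Variables (N : nat) (G : rel 'I_N) (J : rel ('I_N + 'I_N)).

Notation H := (horizontal G J).
Notation Hu := (underlying (horizontal G J)).
Notation S := (substitution_graph G J).

Definition parent (x : seq 'I_N) := take (size x).-1 x.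

Lemma parent_rcons x i : parent (rcons x i) = x.
Proof. by rewrite /parent size_rcons -cats1 take_size_cat. Qed.

Lemma parent_take l (x : seq 'I_N) :
  l < size x -> parent (take l.+1 x) = take l x.
Proof. by move=> lx; rewrite /parent size_takel //= take_takel. Qed.

Variant horizontal_spec : seq 'I_N -> seq 'I_N -> Prop :=
| HorizontalSiblings w i j of G i j :
    horizontal_spec (rcons w i) (rcons w j)
| HorizontalLift u v i j of H u v & J (inl i) (inr j) :
    horizontal_spec (rcons u i) (rcons v j).

Lemma horizontalP x y : H x y -> horizontal_spec x y.
Proof. by case=> *; constructor. Qed.

Lemma horizontal_size x y : H x y -> size x = size y.
Proof. by elim=> *; rewrite !size_rcons; lia. Qed.

Lemma horizontal_take l x y :
  H x y -> take l x = take l y \/ H (take l x) (take l y).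
Proof.
move=> xy; elim: (xy) => {x y xy} [w i j ij Gij|u v i j ij uv IH Jij].
  case: (leqP l (size w)) => lw.
    by left; rewrite -!cats1 !takel_cat.
  by right; rewrite !take_oversize ?size_rcons //; apply: horizontal_siblings.
have suv := horizontal_size uv.
case: (leqP l (size u)) => lu.
  by rewrite -!cats1 !takel_cat // -suv.
right; rewrite !take_oversize ?size_rcons -?suv //.
exact: horizontal_lift.
Qed.

Lemma underlying_horizontal_take l x y :
  Hu x y -> take l x = take l y \/ Hu (take l x) (take l y).
Proof.
case=> /(horizontal_take l) [eq_l|e_l]; [by left|right; by left|by left|].
by right; right.
Qed.

Lemma coupling_inl i j : G i j -> coupling_graph G J (inl i) (inl j).
Proof. by move=> Gij; rewrite /coupling_graph Gij. Qed.

Lemma coupling_inr i j : G i j -> coupling_graph G J (inr i) (inr j).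
Proof. by move=> Gij; rewrite /coupling_graph Gij. Qed.

Lemma coupling_J x y : J x y -> coupling_graph G J x y.
Proof. by move=> Jxy; rewrite /coupling_graph Jxy orbT. Qed.

(** The outgoing edges at [rcons u i] come from edges of [G] leaving [i] and
    from edges of [J] leaving [i]; the coupling graph has both kinds at the
    vertex [inl i], so its out-degree there bounds them together. *)
Lemma horizontal_out_functional :
    (forall x, out_degree (coupling_graph G J) x <= 1) ->
  functional H.
Proof.
move=> deg; have uniq_out a b c :
    coupling_graph G J a b -> coupling_graph G J a c -> b = c.
  by move=> ab ac; apply: (card_le1_eqP (deg a)); rewrite inE.
move=> x y z xy; elim: xy z => {x y} [w i j _ Gij|u v i j _ uv IH Jij] z.
all: move E: (rcons _ i) => x /horizontalP xz.
all: case: xz E => [w' i' j' Gij'|u' v' i' j' uv' Jij'] /rcons_inj [ew ei].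
- rewrite -ei in Gij'; congr rcons => //.
  by have [] := uniq_out _ _ _ (coupling_inl Gij) (coupling_inl Gij').
- rewrite -ei in Jij'.
  by have [] := uniq_out _ _ _ (coupling_inl Gij) (coupling_J Jij').
- rewrite -ei in Gij'.
  by have [] := uniq_out _ _ _ (coupling_J Jij) (coupling_inl Gij').
- rewrite -ei in Jij'; rewrite -ew in uv'; congr rcons; first exact: IH.
  by have [] := uniq_out _ _ _ (coupling_J Jij) (coupling_J Jij').
Qed.

(** Here the vertex that sees both kinds of edges is the primed letter: edges
    of [J] arrive at [inr j], as do the primed copies of the edges of [G]. *)
Lemma horizontal_in_functional :
    (forall x, in_degree (coupling_graph G J) x <= 1) ->
  functional (fun x y => H y x).
Proof.
move=> deg; have uniq_in a b c :
    coupling_graph G J b a -> coupling_graph G J c a -> b = c.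
  by move=> ba ca; apply: (card_le1_eqP (deg a)); rewrite inE.
move=> x y z yx; elim: yx z => {x y} [w i j _ Gij|u v i j _ uv IH Jij] z.
all: move E: (rcons _ j) => x /horizontalP zx.
all: case: zx E => [w' i' j' Gij'|u' v' i' j' uv' Jij'] /rcons_inj [ew ej].
- rewrite -ej in Gij'; congr rcons => //.
  by have [] := uniq_in _ _ _ (coupling_inl Gij) (coupling_inl Gij').
- rewrite -ej in Jij'.
  by have [] := uniq_in _ _ _ (coupling_inr Gij) (coupling_J Jij').
- rewrite -ej in Gij'.
  by have [] := uniq_in _ _ _ (coupling_J Jij) (coupling_inr Gij').
- rewrite -ej in Jij'; rewrite -ew in uv'; congr rcons; first exact: IH.
  by have [] := uniq_in _ _ _ (coupling_J Jij) (coupling_J Jij').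
Qed.

(** * Projecting directed horizontal walks *)

(** A sibling edge collapses when projected to the parents, whereas a lifted
    edge records an edge of [J] between the last letters. *)
Lemma horizontal_walk_parent i0 x y n :
    walk H x y n ->
  (exists2 p, p < n & walk H (parent x) (parent y) p) \/
  (walk (K_edge J) (last i0 x) (last i0 y) n /\
   walk H (parent x) (parent y) n).
Proof.
elim=> [z|{x y n} x t y n xt _ IH]; first by right; split; apply: walk_nil.
case: (horizontalP xt) IH => [w i j _|u v i j uv Jij];
  rewrite !parent_rcons !last_rcons.
  move=> IH; left; case: IH => [[p pn wy]|[_ wy]]; last by exists n.
  by exists p => //; lia.
case=> [[p pn vy]|[jy vy]].
  by left; exists p.+1 => //; apply: walk_cons uv vy.
by right; split; [apply: walk_cons Jij jy | apply: walk_cons uv vy].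
Qed.

Section Shortening.
Variable m : nat.
Hypothesis nilK : (K_matrix J ^+ m = 0)%R.
Variable i0 : 'I_N.

(** Otherwise all [m] edges would be lifted, and the last letters would trace a
    walk of length [m] counted by [K ^+ m = 0]. *)
Lemma horizontal_block_shortens x y :
  walk H x y m -> exists2 p, p < m & walk H (parent x) (parent y) p.
Proof.
move=> /(horizontal_walk_parent i0) [//|[Kxy _]].
by case: (K_nilpotent_no_walk nilK Kxy).
Qed.

Lemma horizontal_walk_shortens x y n :
    walk H x y n ->
  exists p, [/\ walk H (parent x) (parent y) p, p <= n &
                2 * m <= n -> p + 2 <= n].
Proof.
move=> xy; case: (leqP (2 * m) n) => mn; last first.
  case: (horizontal_walk_parent i0 xy) => [[p pn xy']|[_ xy']].
    by exists p; split=> //; lia.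
  by exists n; split=> //; lia.
have en : n = m + (m + (n - 2 * m)) by lia.
rewrite en in xy.
have [s xs sy] := walk_split xy; have [t st ty] := walk_split sy.
have [p pm xs'] := horizontal_block_shortens xs.
have [q qm st'] := horizontal_block_shortens st.
have [r rn ty'] : exists2 r, r <= n - 2 * m & walk H (parent t) (parent y) r.
  case: (horizontal_walk_parent i0 ty) => [[r rn ty']|[_ ty']].
    by exists r => //; lia.
  by exists (n - 2 * m).
exists (p + (q + r)); split; try lia.
exact: walk_cat xs' (walk_cat st' ty').
Qed.

Hypothesis funH : functional H \/ functional (fun x y => H y x).

(** The constant: of two directed walks of total length at least [4 m - 1], one
    has length at least [2 m] and loses two edges; a smaller total is already
    two less than [4 m]. *)
Lemma undirected_walk_shortens x y n :
    walk Hu x y n -> 4 * m <= n ->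
  exists2 p, p + 2 <= n & walk Hu (parent x) (parent y) p.
Proof.
have sub u v k : walk H u v k -> walk Hu u v k.
  by apply: walk_mono => ? ?; left.
move=> xy mn; case: funH => [fun_out|fun_in].
  have [c [p [q [xc yc pq]]]] := functional_fold fun_out xy.
  have [p' [xc' pp' p'2]] := horizontal_walk_shortens xc.
  have [q' [yc' qq' q'2]] := horizontal_walk_shortens yc.
  exists (p' + q'); first by lia.
  exact: walk_cat (sub _ _ _ xc') (walk_underlying_sym (sub _ _ _ yc')).
have yx : walk (underlying (fun x y => H y x)) x y n.
  by apply: walk_mono xy => u v [|]; [right|left].
have [c [p [q [xc yc pq]]]] := functional_fold fun_in yx.
have [cx cy] := (walk_flip xc, walk_flip yc).
have [p' [cx' pp' p'2]] := horizontal_walk_shortens cx.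
have [q' [cy' qq' q'2]] := horizontal_walk_shortens cy.
exists (p' + q'); first by lia.
exact: walk_cat (walk_underlying_sym (sub _ _ _ cx')) (sub _ _ _ cy').
Qed.

(** Induction on the level: as long as the crossing is too long, moving it to
    the parents does not increase the total length. At level zero both ends
    are the root. *)
Lemma short_crossing l x y n :
    l <= size x -> l <= size y -> walk Hu (take l x) (take l y) n ->
  exists l' n', [/\ l' <= l, n' <= 4 * m, n' + 2 * l <= n + 2 * l' &
                    walk Hu (take l' x) (take l' y) n'].
Proof.
elim: l n => [|l IH] n lx ly xy.
  by exists 0, 0; split=> //; rewrite !take0; apply: walk_nil.
case: (leqP n (4 * m)) => [nm|/ltnW mn]; first by exists l.+1, n.
have [p pn] := undirected_walk_shortens xy mn.
rewrite !parent_take // => xy'.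
have [l' [n' [l'l n'm cost xy'']]] := IH p (ltnW lx) (ltnW ly) xy'.
by exists l', n'; split=> //; lia.
Qed.

End Shortening.

(** * Distances in the substitution graph *)

Lemma walk_ancestor l x : l <= size x -> walk S (take l x) x (size x - l).
Proof.
elim/last_ind: x => [|x i IH].
  by case: l => // _; apply: walk_nil.
rewrite size_rcons leq_eqVlt => /orP [/eqP ->|lx].
  by rewrite subnn take_oversize ?size_rcons //; apply: walk_nil.
rewrite subSn // -cats1 takel_cat // cats1.
by apply: walk_rcons (IH lx) _; left; left; exists i.
Qed.

Lemma walk_descendant l x : l <= size x -> walk S x (take l x) (size x - l).
Proof. by move=> lx; apply: walk_underlying_sym; apply: walk_ancestor. Qed.

Lemma walk_horizontal x y n : walk Hu x y n -> walk S x y n.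
Proof. by apply: walk_mono => u v [|]; [left; right|right; right]. Qed.

Lemma walk_crossing l x y n :
    l <= size x -> l <= size y -> walk Hu (take l x) (take l y) n ->
  walk S x y ((size x - l) + n + (size y - l)).
Proof.
move=> lx ly /walk_horizontal xy.
exact: walk_cat (walk_cat (walk_descendant lx) xy) (walk_ancestor ly).
Qed.

Lemma walk_take_horizontal l x y n :
    walk Hu x y n ->
  exists2 p, p <= n & walk Hu (take l x) (take l y) p.
Proof. exact/walk_project/underlying_horizontal_take. Qed.

(** Only a vertical edge leading down to the level of the crossing forces the
    crossing to move, one level up; a horizontal edge either vanishes at the
    level of the crossing or prolongs it. *)
Lemma walk_normal_form x y n :
    walk S x y n ->
  exists l h, [/\ l <= size x, l <= size y, walk Hu (take l x) (take l y) h &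
                  size x + size y + h <= n + 2 * l].
Proof.
elim=> [z|{x y n} x t y n xt _ [l [h [lt ly ty cost]]]].
  by exists (size z), 0; split=> //; [apply: walk_nil|lia].
have horiz : Hu x t -> exists l h, [/\ l <= size x, l <= size y,
    walk Hu (take l x) (take l y) h & size x + size y + h <= n.+1 + 2 * l].
  move=> xt'; have sxt : size x = size t.
    by case: xt' => /horizontal_size.
  exists l; case: (underlying_horizontal_take l xt') => [->|xt''].
    by exists h; split=> //; lia.
  by exists h.+1; split; [lia|lia|apply: walk_cons xt'' ty|lia].
case: xt => [[[i et]|xt]|[[i ex]|tx]]; last by apply: horiz; right.
- rewrite {}et size_rcons in lt ty cost *.
  case: (leqP l (size x)) => lx.
    exists l, h; split=> //; last by lia.
    by move: ty; rewrite -cats1 takel_cat.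
  (* The crossing starts at the child [t] itself and moves to its parent [x]:
     the descent to [y] gets one edge longer, and the edge from [x] to [t] is
     saved. *)
  have el : l = (size x).+1 by lia.
  have [p ph] := walk_take_horizontal (size x) ty.
  rewrite !take_takel ?el // -cats1 take_size_cat // => xy.
  by exists (size x), p; rewrite take_size; split=> //; lia.
- by apply: horiz; left.
- rewrite {}ex size_rcons; exists l, h; split=> //; try lia.
  by rewrite -cats1 takel_cat.
Qed.

Lemma gdist_root x : gdist (substitution_graph_connected G J) [::] x = size x.
Proof.
set ce := substitution_graph_connected G J.
apply/eqP; rewrite eqn_leq; apply/andP; split.
  apply: gdist_le; rewrite -(subn0 (size x)) -(take0 x).
  exact: walk_ancestor.
have [l [h [/= l0 _ _ cost]]] := walk_normal_form (gdist_walk ce [::] x).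
by lia.
Qed.

(** Short crossings are stable under projection, so two of them can be compared
    and concatenated at the lower of their two levels. *)
Lemma hyperbolic_of_short_crossings (R : realType) (L : nat) :
    (forall x y n, walk S x y n ->
      exists l h, [/\ l <= size x, l <= size y, h <= L,
        walk Hu (take l x) (take l y) h & size x + size y + h <= n + 2 * l]) ->
  substitution_hyperbolic G J R.
Proof.
move=> short; exists L%:R%R; split; first exact: ler0n.
move=> u v w; rewrite /gromov_product !gdist_root.
set ce := substitution_graph_connected G J.
have [l1 [h1 [l1u l1w h1L uw cost1]]] := short _ _ _ (gdist_walk ce u w).
have [l2 [h2 [l2w l2v h2L wv cost2]]] := short _ _ _ (gdist_walk ce w v).
pose l := minn l1 l2.
have [p ph1 uw'] := walk_take_horizontal l uw.
have [q qh2 wv'] := walk_take_horizontal l wv.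
rewrite !take_takel ?geq_minl ?geq_minr // in uw' wv'.
have lu : l <= size u by lia.
have lv : l <= size v by lia.
have := gdist_le ce (walk_crossing lu lv (walk_cat uw' wv')).
move=> duv; have {}duv : gdist ce u v + 2 * l <= size u + size v + 2 * L by lia.
have natR a b : a <= b -> (a%:R <= b%:R :> R)%R by rewrite ler_nat.
have := natR _ _ duv; have := natR _ _ cost1; have := natR _ _ cost2.
have h1_ge0 : (0 <= h1%:R :> R)%R by apply: ler0n.
have h2_ge0 : (0 <= h2%:R :> R)%R by apply: ler0n.
rewrite !natrD /l => wvR uwR uvR.
rewrite lerBlDr ge_min; apply/orP.
case: (leqP l1 l2) uvR => [le12|lt21] uvR; [left|right]; lra.
Qed.

End Substitution.

Theorem theorem3 (R : realType) (N : nat) (hN : (2 <= N)%N)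
    (G : rel 'I_N)
    (G_loopless : forall i : 'I_N, ~~ G i i)
    (G_simple : forall i j : 'I_N, G i j -> ~~ G j i)
    (G_nonempty : exists i j : 'I_N, G i j)
    (J : rel ('I_N + 'I_N)%type)
    (J_edges : forall x y : ('I_N + 'I_N)%type,
       J x y -> exists i j : 'I_N, x = inl i /\ y = inr j)
    (J_nonempty : exists x y : ('I_N + 'I_N)%type, J x y)
    (K_nilpotent : mx_nilpotent (K_matrix J))
    (degrees :
       (forall x, (out_degree (coupling_graph G J) x <= 1)%N) \/
       (forall x, (in_degree (coupling_graph G J) x <= 1)%N)) :
  substitution_hyperbolic G J R.
Proof.
case: K_nilpotent => m nilK; case: G_nonempty => i0 _.
have funH : functional (horizontal G J) \/
    functional (fun x y => horizontal G J y x).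
  case: degrees => deg; first by left; apply: horizontal_out_functional.
  by right; apply: horizontal_in_functional.
apply: (@hyperbolic_of_short_crossings _ _ _ _ (4 * m)) => x y n.
move=> /walk_normal_form [l [h [lx ly xy cost]]].
have [l' [h' [l'l h'm cost' xy']]] := short_crossing nilK i0 funH lx ly xy.
by exists l', h'; split=> //; lia.
Qed.
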